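(* Let $f=(f_1,\dots,f_N)$ be a system of polynomials in $\mathbb{C}[x_1,\dots,x_n]$, $N\ge n$, having exactly $e$ solutions and whose general square subsystems have $d$ solutions. Let $g,g'$ be two square subsystems of $f$, each having $d$ solutions, and let $S=\{\hat\zeta_1,\dots,\hat\zeta_d\}$ be a set of $d$ distinct approximate solutions to $g$, $B=\{B(\hat\zeta_1,\rho_1),\dots,B(\hat\zeta_d,\rho_d)\}$ disjoint balls separating the elements of $S$, and $S'$ a set of $d$ distinct approximate solutions to $g'$. Then the algorithm described in the context, run on input $(d,e,f,g,g',S,S',B)$, either returns FAIL or returns a set $T\subset S$ of approximate solutions to $f$ whose associated solutions are all the solutions to $f$.
   Context: For a polynomial system $h$ in $n$ variables, $\mathcal{V}(h)\subset\mathbb{C}^n$ is its set of solutions (common zeros); $h$ is square if it consists of $n$ polynomials. A square subsystem of $f$ is a square system $g$ with $\mathcal{V}(f)\subset\mathcal{V}(g)$; a general one is $g=Af$ for a generic matrix $A\in\mathbb{C}^{n\times N}$. Thus $\#\mathcal{V}(f)=e\le d=\#\mathcal{V}(g)=\#\mathcal{V}(g')$. $\|\cdot\|$ is the Hermitian norm on $\mathbb{C}^n$. Approximate solution: an approximate solution to $h$ is a triple $(\hat\zeta,\rho,\mathcal{N})$ with $\hat\zeta\in\mathbb{C}^n$, $\rho\in\mathbb{R}_{>0}$, and $\mathcal{N}\colon U\to\mathbb{C}^n$ a map on some $U\subset\mathbb{C}^n$, such that (1) there is $\zeta\in\mathcal{V}(h)$ with $\|\zeta-\hat\zeta\|<\rho$,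 and (2) all iterates $\mathcal{N}^k(\hat\zeta)$ are defined and converge to this $\zeta$. The point $\zeta$ is the solution associated to $\hat\zeta$. Distinct approximate solutions means that their associated solutions are pairwise distinct. Input conventions: each $\hat\zeta_i\in S$ is a $\rho_i$-approximate solution to $g$, with $\rho_i$ the radius of its ball in $B$, and with refinement operator $\mathcal{N}_g$; elements of $T$ are approximate solutions to $f$ with these same radii and this same refinement operator. The balls in $B$ are pairwise disjoint in the sense that $\|\hat\zeta_i-\hat\zeta_j\|>\rho_i+\rho_j$ for $i\ne j$. The elements of $S'$ are approximate solutions to $g'$ in the sense of $\alpha$-theory, with the Newton operator $N_{g'}(z)=z-Dg'(z)^{-1}g'(z)$ as refinement operator: each $\hat\zeta'\in S'$ satisfies $\alpha(g',\hat\zeta')<\frac{13-3\sqrt{17}}{4}$, where $\alpha(g',z)=\beta(g',z)\gamma(g',z)$, $\beta(g',z)=\|Dg'(z)^{-1}g'(z)\|$, and $\gamma(g',z)=\sup_{k\ge2}\bigl\|\tfrac{Dg'(z)^{-1}(D^kg')_z}{k!}\bigr\|^{1/(k-1)}$ (operator norms of the derivative regarded as a linear map on $S^k\mathbb{C}^n$, which carries the norm dual to the unitarily invariant norm on homogeneous polynomials). Algorithm: 1. Set $T=\emptyset$. 2. Set $r=\min_{1\le i<j\le d}\bigl(\|\hat\zeta_i-\hat\zeta_j\|-(\rho_i+\rho_j)\bigr)$ (with $r=+\infty$ if $d\le 1$). 3. For each $\hat\zeta'\in S'$: repeat $\hat\zeta'\leftarrow N_{g'}(\hat\zeta')$ until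 $2\beta(g',\hat\zeta')<r/3$; set $\rho'=2\beta(g',\hat\zeta')$; for each $j=1,\dots,d$, if the balls $B(\hat\zeta_j,\rho_j)$ and $B(\hat\zeta',\rho')$ meet, which is decided by the test $\rho'+\rho_j>\|\hat\zeta_j-\hat\zeta'\|$, then add $\hat\zeta_j$ to $T$. 4. If $\#T=e$, return $T$; otherwise return FAIL. *)

(* Defs.v *)
From HB Require Import structures.
From mathcomp Require Import all_boot all_order all_algebra.
(* mpoly must precede the analysis files: in the other order their notations
   clash. *)
From mathcomp Require Import finmap complex mpoly.
From mathcomp Require Import boolp classical_sets functions cardinality.
From mathcomp Require Import reals ereal topology normedtype sequences exp.

Set Implicit Arguments.
Unset Strict Implicit.
Unset Printing Implicit Defensive.

Import Order.TTheory GRing.Theory Num.Theory.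
Import numFieldNormedType.Exports.

Local Open Scope classical_set_scope.
Local Open Scope ring_scope.

Section Systems.
Variables (R : realType) (n : nat).
Local Notation C := R[i].
Local Notation point := 'cV[C]_n.

Definition hnorm (z : point) : R :=
  Num.sqrt (\sum_(i < n) Normc.normc (z i 0) ^+ 2).

Definition peval (p : {mpoly C[n]}) (z : point) : C := p.@[fun i => z i 0].

Definition seval (g : 'I_n -> {mpoly C[n]}) (z : point) : point :=
  \col_i peval (g i) z.

Definition zeros (N : nat) (h : 'I_N -> {mpoly C[n]}) : set point :=
  [set z | forall i, peval (h i) z = 0].

Definition square_subsystem (N : nat) (f : 'I_N -> {mpoly C[n]})
    (g : 'I_n -> {mpoly C[n]}) : Prop :=
  zeros f `<=` zeros g.

Definition mx_subsystem (N : nat) (A : 'M[C]_(n, N))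
    (f : 'I_N -> {mpoly C[n]}) : 'I_n -> {mpoly C[n]} :=
  fun i => \sum_(j < N) A i j *: f j.

(* "Generic A" means: A in some nonempty Zariski open subset of the space of
   n x N matrices; it is enough to consider the nonvanishing locus of one
   nonzero polynomial P in the n * N entries of A. *)
Definition general_square_subsystems_have (N : nat)
    (f : 'I_N -> {mpoly C[n]}) (d : nat) : Prop :=
  exists2 P : {mpoly C[n * N]}, P != 0 &
    forall A : 'M[C]_(n, N), P.@[fun k => mxvec A 0 k] != 0 ->
      (zeros (mx_subsystem A f) #= `I_d)%card.

(* A map U -> C^n with U a subset of C^n is encoded as point -> option point;
   U is the set of points that are not sent to None. *)
Definition iterates_converge (Op : point -> option point)
    (z zeta : point) : Prop :=
  exists2 x : nat -> point,
    forall k, iter k (obind Op) (Some z) = Some (x k) &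
    hnorm (x k - zeta) @[k --> \oo] --> (0 : R).

Definition associated_solution (N : nat) (h : 'I_N -> {mpoly C[n]})
    (z : point) (rho : R) (Op : point -> option point) (zeta : point) : Prop :=
  [/\ zeros h zeta, hnorm (zeta - z) < rho & iterates_converge Op z zeta].

Definition approximate_solution (N : nat) (h : 'I_N -> {mpoly C[n]})
    (z : point) (rho : R) (Op : point -> option point) : Prop :=
  0 < rho /\ exists zeta, associated_solution h z rho Op zeta.

Definition distinct_approximate_solutions (N d : nat)
    (h : 'I_N -> {mpoly C[n]}) (z : 'I_d -> point) (rho : 'I_d -> R)
    (Op : point -> option point) : Prop :=
  (forall i, approximate_solution h (z i) (rho i) Op) /\
  (forall i j zeta1 zeta2, i != j ->
     associated_solution h (z i) (rho i) Op zeta1 ->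
     associated_solution h (z j) (rho j) Op zeta2 -> zeta1 <> zeta2).

Definition jacobian (g : 'I_n -> {mpoly C[n]}) (z : point) : 'M[C]_n :=
  \matrix_(i, j) peval (g i)^`M(j) z.

Definition newton (g : 'I_n -> {mpoly C[n]}) (z : point) : option point :=
  if jacobian g z \in unitmx
  then Some (z - invmx (jacobian g z) *m seval g z) else None.

(* beta, gamma and alpha are meaningful only where the jacobian is
   invertible. *)
Definition beta (g : 'I_n -> {mpoly C[n]}) (z : point) : R :=
  hnorm (invmx (jacobian g z) *m seval g z).

Section SymmetricPower.
Variable k : nat.

(* The unitarily invariant (Bombieri-Weyl) norm on forms of degree k:
   |\sum_m a_m x^m|^2 = \sum_m |a_m|^2 / (k! / (m_1! ... m_n!)). *)
Definition form_norm (p : dhomog n C k) : R :=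
  Num.sqrt (\sum_(m <- msupp p)
    Normc.normc (p@_m) ^+ 2 / ((k`!)%:R / (\prod_(i < n) (m i)`!)%N%:R)).

(* S^k C^n is realized as the dual of the space of forms of degree k, the
   power v^k being evaluation at v. *)
Definition sym_power : Type := {linear dhomog n C k -> C^o}.

(* All the suprema below are suprema of nonempty bounded sets of reals:
   the spaces are finite dimensional and the g_i are polynomials. *)
Definition sym_power_norm (s : sym_power) : R :=
  sup [set Normc.normc (s p) | p in [set p | form_norm p <= 1]].

Definition sym_operator_norm (L : sym_power -> point) : R :=
  sup [set hnorm (L s) | s in [set s | sym_power_norm s <= 1]].

(* The form v |-> (D^k p)_z(v, ..., v), i.e. the sum over all
   (i_1, ..., i_k) of (d_{i_1} ... d_{i_k} p)(z) v_{i_1} ... v_{i_k}. *)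
Definition derivative_mpoly (p : {mpoly C[n]}) (z : point) : {mpoly C[n]} :=
  \sum_(t : k.-tuple 'I_n)
    peval (foldr (fun i q => q^`M(i)) p t) z *: \prod_(i <- t) 'X_i.

Lemma derivative_mpoly_homog p z : derivative_mpoly p z \is k.-homog.
Proof.
apply: rpred_sum => t _; apply: rpredZ.
by rewrite mprodXE dhomogX /= mdeg_sum (eq_bigr (fun=> 1%N)) => [|i _];
  rewrite ?mdeg1 // sum1_size size_tuple.
Qed.

Definition derivative_form (p : {mpoly C[n]}) (z : point) : dhomog n C k :=
  DHomog (derivative_mpoly_homog p z).

(* (D^k g)_z as a linear map S^k C^n -> C^n. *)
Definition derivative_map (g : 'I_n -> {mpoly C[n]}) (z : point)
    (s : sym_power) : point :=
  \col_i s (derivative_form (g i) z).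

End SymmetricPower.

Definition gamma_term (g : 'I_n -> {mpoly C[n]}) (z : point) (k : nat) : R :=
  @sym_operator_norm k (fun s =>
    (k`!)%:R^-1 *: (invmx (jacobian g z) *m derivative_map g z s))
  `^ (k.-1)%:R^-1.

Definition gamma (g : 'I_n -> {mpoly C[n]}) (z : point) : R :=
  sup [set gamma_term g z k | k in [set k | (2 <= k)%N]].

Definition alpha (g : 'I_n -> {mpoly C[n]}) (z : point) : R :=
  beta g z * gamma g z.

Definition alpha_certified (g : 'I_n -> {mpoly C[n]}) (z : point) : Prop :=
  jacobian g z \in unitmx /\ alpha g z < (13 - 3 * Num.sqrt 17) / 4.

End Systems.

Section Algorithm.
Variables (R : realType) (n d : nat).
Local Notation C := R[i].
Local Notation point := 'cV[C]_n.
Variables (e : nat) (g' : 'I_n -> {mpoly C[n]}).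
Variables (zS : 'I_d -> point) (rho : 'I_d -> R) (zS' : 'I_d -> point).

Definition separation : \bar R :=
  \big[Order.min/+oo%E]_(p : 'I_d * 'I_d | (p.1 < p.2)%N)
    (hnorm (zS p.1 - zS p.2) - (rho p.1 + rho p.2))%:E.

Definition small_enough (z : point) : bool :=
  ((2 * beta g' z)%:E < separation * (3^-1)%:E)%E.

(* refine_until z w: the loop "repeat z <- N_{g'}(z) until 2 beta(g', z) < r/3"
   started at z terminates with value w; the test can only be evaluated where
   the jacobian of g' is invertible. *)
Inductive refine_until (z : point) : point -> Prop :=
| refine_stop z1 : newton g' z = Some z1 -> jacobian g' z1 \in unitmx ->
    small_enough z1 -> refine_until z z1
| refine_again z1 w : newton g' z = Some z1 -> jacobian g' z1 \in unitmx ->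
    ~~ small_enough z1 -> refine_until z1 w -> refine_until z w.

Definition balls_meet (w : point) (j : 'I_d) : bool :=
  2 * beta g' w + rho j > hnorm (zS j - w).

Definition add_meeting (w : point) (T : {fset point}) : {fset point} :=
  foldl (fun T j => if balls_meet w j then zS j |` T else T)%fset
    T (enum 'I_d).

(* process s T T': step 3, performed for the points of s with the current
   value T of the set being built, terminates with the value T'. *)
Inductive process : seq point -> {fset point} -> {fset point} -> Prop :=
| process_nil T : process [::] T T
| process_cons z w s T T' : refine_until z w ->
    process s (add_meeting w T) T' -> process (z :: s) T T'.

(* The output None stands for FAIL. *)
Definition algorithm_returns (out : option {fset point}) : Prop :=
  exists2 T : {fset point},
    process [seq zS' i | i <- enum 'I_d] fset0 T &
    out = if #|` T| == e then Some T else None.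

End Algorithm.

(* Main.v *)
(** Every solution of f solves g and g', so it is the solution associated to a
    unique point of S and to a unique point of S'. By alpha-theory a refined
    point w of S' lies within 2 beta(g', w) of its solution, hence the ball around
    w meets the ball around the point of S with the same solution: the e points
    of S associated to solutions of f always end up in T, and #T = e forces T to
    consist of exactly these points.

    For the alpha-theory, consider the bounds
      |Dg(x)^-1 D^k g(x)(v_1, ..., v_k)| <= k! c^(k-1) |v_1| ... |v_k|, k >= 2,
    on directional derivatives. They hold for c = gamma(g, x), because the
    symmetric product v_1 ... v_k has dual norm at most |v_1| ... |v_k|. With
    u = c beta(g, x) and psi = 1 - 4u + 2u^2, Taylor expansion at x turns them
    into the same bounds at N_g(x) for the constant c / ((1 - u) psi), and gives
    beta(g, N_g(x)) <= beta(g, x) u (1 - u) / psi. If u < 4/25, then the new u is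
    no larger and beta is at least halved. *)

Require Import Defs.
From HB Require Import structures.
From mathcomp Require Import all_boot all_order all_algebra.
From mathcomp Require Import finmap complex mpoly.
From mathcomp Require Import boolp classical_sets functions cardinality.
From mathcomp Require Import reals ereal topology normedtype sequences exp.
From mathcomp Require Import ring lra.

Set Implicit Arguments.
Unset Strict Implicit.
Unset Printing Implicit Defensive.

Import Order.TTheory GRing.Theory Num.Theory.
Import numFieldNormedType.Exports.

Local Open Scope classical_set_scope.
Local Open Scope ring_scope.

(** * The Hermitian norm *)

(** Lagrange's identity: twice the gap is the double sum of the squares
    [(a i * b j - a j * b i) ^+ 2]. *)
Lemma sqr_sum_mul_le (R : realDomainType) (I : finType) (a b : I -> R) :
  (\sum_i a i * b i) ^+ 2 <= (\sum_i a i ^+ 2) * (\sum_i b i ^+ 2).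
Proof.
have : 0 <= \sum_i \sum_j (a i * b j - a j * b i) ^+ 2.
  by apply: sumr_ge0 => i _; apply: sumr_ge0 => j _; apply: sqr_ge0.
have -> : \sum_i \sum_j (a i * b j - a j * b i) ^+ 2 =
    \sum_i \sum_j (a i ^+ 2 * b j ^+ 2 + b i ^+ 2 * a j ^+ 2)
    - (\sum_i \sum_j (a i * b i) * (a j * b j)) *+ 2.
  rewrite -sumrMnl -sumrB; apply: eq_bigr => i _.
  rewrite -sumrMnl -sumrB; apply: eq_bigr => j _; ring.
rewrite -[\sum_i \sum_j a i * b i * _]big_distrlr /=.
under eq_bigr do rewrite big_split /=.
rewrite big_split /= -2!big_distrlr /= -expr2.
move: (\sum_i a i ^+ 2) (\sum_i b i ^+ 2) (\sum_i a i * b i) => A B S; lra.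
Qed.

Section HermitianNorm.
Variables (R : realType).
Local Notation normc := Normc.normc.

Lemma normc_ge0 (x : R[i]) : 0 <= normc x.
Proof. by case: x => a b; apply: sqrtr_ge0. Qed.

Lemma normc_triangle (x y : R[i]) : normc (x + y) <= normc x + normc y.
Proof. exact: le_normcD. Qed.

Lemma normc_nat k : normc (k%:R : R[i]) = k%:R.
Proof. by rewrite (normcMn (1 : R[i])) Normc.normc1. Qed.

Lemma normc_real (x : R) : 0 <= x -> normc (x%:C)%C = x.
Proof. by move=> x0; rewrite /= expr0n addr0 sqrtr_sqr ger0_norm. Qed.

Lemma normc_sum (I : Type) (r : seq I) (P : pred I) (F : I -> R[i]) :
  normc (\sum_(i <- r | P i) F i) <= \sum_(i <- r | P i) normc (F i).
Proof.
elim/big_rec2: _ => [|i y x _ xy]; first by rewrite Normc.normc0.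
by apply: le_trans (normc_triangle _ _) _; rewrite lerD2l.
Qed.

Variable n : nat.
Implicit Types z w : 'cV[R[i]]_n.

Lemma hnorm_ge0 z : 0 <= hnorm z.
Proof. exact: sqrtr_ge0. Qed.

Lemma sqr_hnorm z : hnorm z ^+ 2 = \sum_i normc (z i 0) ^+ 2.
Proof. by rewrite sqr_sqrtr // sumr_ge0 // => i _; apply: sqr_ge0. Qed.

Lemma hnorm_triangle z w : hnorm (z + w) <= hnorm z + hnorm w.
Proof.
rewrite -(@ler_pXn2r _ 2) ?nnegrE ?addr_ge0 ?hnorm_ge0 //.
rewrite sqr_hnorm; apply: (@le_trans _ _
  (\sum_i (normc (z i 0) + normc (w i 0)) ^+ 2)).
  apply: ler_sum => i _; rewrite mxE ler_pXn2r ?nnegrE ?addr_ge0 ?normc_ge0 //.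
  exact: normc_triangle.
have -> : \sum_i (normc (z i 0) + normc (w i 0)) ^+ 2 =
  hnorm z ^+ 2 + hnorm w ^+ 2 + (\sum_i normc (z i 0) * normc (w i 0)) *+ 2.
  rewrite !sqr_hnorm -sumrMnl -!big_split /=; apply: eq_bigr => i _; ring.
rewrite sqrrD addrAC lerD2r lerD2l ler_wMn2r //.
rewrite -(@ler_pXn2r _ 2) ?nnegrE ?mulr_ge0 ?hnorm_ge0 //; last first.
  by apply: sumr_ge0 => i _; rewrite mulr_ge0 ?normc_ge0.
by rewrite exprMn !sqr_hnorm sqr_sum_mul_le.
Qed.

Lemma hnorm_scale c z : hnorm (c *: z) = normc c * hnorm z.
Proof.
apply/(@pexpIrn _ 2); rewrite ?nnegrE ?mulr_ge0 ?normc_ge0 ?hnorm_ge0 //.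
rewrite exprMn !sqr_hnorm mulr_sumr; apply: eq_bigr => i _.
by rewrite mxE Normc.normcM exprMn.
Qed.

Lemma hnorm0 : hnorm (0 : 'cV[R[i]]_n) = 0.
Proof. by rewrite -(scale0r 0) hnorm_scale Normc.normc0 mul0r. Qed.

Lemma hnorm_opp z : hnorm (- z) = hnorm z.
Proof. by rewrite -scaleN1r hnorm_scale (normcN (1 : R[i])) Normc.normc1 mul1r. Qed.

Lemma hnorm_distC z w : hnorm (z - w) = hnorm (w - z).
Proof. by rewrite -hnorm_opp opprB. Qed.

Lemma hnorm_dist_triangle v z w : hnorm (z - w) <= hnorm (z - v) + hnorm (v - w).
Proof. by rewrite -[z - w](subrKA v) hnorm_triangle. Qed.

Lemma hnorm_sum (I : Type) (r : seq I) (P : pred I) (F : I -> 'cV[R[i]]_n) :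
  hnorm (\sum_(i <- r | P i) F i) <= \sum_(i <- r | P i) hnorm (F i).
Proof.
elim/big_rec2: _ => [|i y x _ xy]; first by rewrite hnorm0.
by apply: le_trans (hnorm_triangle _ _) _; rewrite lerD2l.
Qed.

Lemma hnorm_eq0 z : hnorm z = 0 -> z = 0.
Proof.
move=> z0; apply/matrixP => i j; rewrite (ord1 j) mxE; apply: Normc.eq0_normc.
have /eqP := sqr_hnorm z; rewrite z0 expr0n eq_sym psumr_eq0 => [/allP|k _].
  by move=> /(_ i); rewrite mem_index_enum sqrf_eq0 => /(_ isT)/eqP.
exact: sqr_ge0.
Qed.

Lemma normc_dot_le (a : 'I_n -> R[i]) z :
  normc (\sum_i a i * z i 0) ^+ 2 <= (\sum_i normc (a i) ^+ 2) * hnorm z ^+ 2.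
Proof.
rewrite sqr_hnorm; apply: le_trans (sqr_sum_mul_le _ _).
rewrite ler_pXn2r ?nnegrE ?normc_ge0 ?sumr_ge0 // => [|i _]; last first.
  by rewrite mulr_ge0 ?normc_ge0.
by apply: le_trans (normc_sum _ _ _) _; apply: ler_sum => i _; rewrite Normc.normcM.
Qed.

Lemma hnorm_le_sum z : hnorm z <= \sum_i normc (z i 0).
Proof.
rewrite -(@ler_pXn2r _ 2) ?nnegrE ?hnorm_ge0 ?sumr_ge0 // => [|i _]; last first.
  exact: normc_ge0.
rewrite sqr_hnorm expr2 mulr_sumr; apply: ler_sum => i _.
rewrite expr2 ler_wpM2r ?normc_ge0 // (bigD1 i) //= lerDl sumr_ge0 // => j _.
exact: normc_ge0.
Qed.

End HermitianNorm.

(** * Directional derivatives and the Fischer norm *)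

(** Only the part of [s] where [F] is nonzero has to lie in [t]; this absorbs the monomials of a
    shifted support whose coefficient in [p] vanishes. *)
Lemma sum_subset_le (R : numDomainType) (T : eqType) (s t : seq T) (F : T -> R) :
  uniq s -> uniq t -> (forall x, 0 <= F x) ->
  (forall x, x \in s -> F x != 0 -> x \in t) ->
  \sum_(x <- s) F x <= \sum_(x <- t) F x.
Proof.
move=> us ut F0 st; have -> : \sum_(x <- s) F x = \sum_(x <- t | x \in s) F x.
  rewrite (bigID (mem t)) /= addrC big_seq_cond big1 ?add0r => [|x]; last first.
    by case/andP=> xs xNt; apply/eqP; apply: contraNT xNt; apply: st.
  rewrite -big_filter -[RHS]big_filter; apply: perm_big; apply: uniq_perm.
  - exact: filter_uniq.
  - exact: filter_uniq.
  - by move=> x; rewrite !mem_filter andbC.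
by rewrite [leRHS](bigID (mem s)) /= lerDl sumr_ge0.
Qed.

Section FischerNorm.
Variables (R : realType) (n : nat).
Local Notation C := R[i].
Local Notation normc := Normc.normc.
Implicit Types (p q : {mpoly C[n]}) (v : 'cV[C]_n) (vs : seq 'cV[C]_n).

(** The derivative in a constant direction is kept as a polynomial, so that it can be iterated
    before evaluation. *)
Definition dderiv v p : {mpoly C[n]} := \sum_i v i 0 *: p^`M(i).

Definition dderivs vs p : {mpoly C[n]} := foldr dderiv p vs.

Lemma dderiv_is_linear v : linear (dderiv v).
Proof.
move=> c p q; rewrite /dderiv scaler_sumr -big_split /=; apply: eq_bigr => i _.
by rewrite linearP /= scalerDr !scalerA mulrC.
Qed.

HB.instance Definition _ v :=
  GRing.isLinear.Build C {mpoly C[n]} {mpoly C[n]} _ (dderiv v)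
    (dderiv_is_linear v).

Lemma dderivs_is_linear vs : linear (dderivs vs).
Proof.
elim: vs => [//|v vs ih] c p q.
by rewrite -[LHS]/(dderiv v (dderivs vs _)) ih linearP.
Qed.

HB.instance Definition _ vs :=
  GRing.isLinear.Build C {mpoly C[n]} {mpoly C[n]} _ (dderivs vs)
    (dderivs_is_linear vs).

Lemma dderiv_delta i p : dderiv (delta_mx i 0) p = p^`M(i).
Proof.
rewrite /dderiv (bigD1 i) //= mxE !eqxx scale1r big1 ?addr0 // => j ji.
by rewrite mxE (negbTE ji) scale0r.
Qed.

Lemma mderiv_dderiv i v p : (dderiv v p)^`M(i) = dderiv v p^`M(i).
Proof.
rewrite /dderiv linear_sum; apply: eq_bigr => j _.
by rewrite linearZ /= mderiv_comm.
Qed.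

Lemma dderivC v w p : dderiv v (dderiv w p) = dderiv w (dderiv v p).
Proof.
rewrite {1}/dderiv [dderiv v p]/dderiv linear_sum; apply: eq_bigr => j _ /=.
by rewrite linearZ /= mderiv_dderiv.
Qed.

Lemma mcoeff_dderiv v p m :
  (dderiv v p)@_m = \sum_i v i 0 * (p@_(m + U_(i)) *+ (m i).+1).
Proof.
rewrite /dderiv raddf_sum; apply: eq_bigr => i _ /=.
by rewrite mcoeffZ mcoeff_mderiv.
Qed.

Lemma msize_dderiv v p : (msize (dderiv v p) <= (msize p).-1)%N.
Proof.
rewrite [msize (dderiv v p)]msizeE; apply/bigmax_leqP_seq => m.
rewrite mcoeff_msupp mcoeff_dderiv => nz _.
have [i pmi] : exists i, p@_(m + U_(i)) != 0.
  apply/existsP; apply: contraNT nz; rewrite negb_exists => /forallP z.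
  by rewrite big1 // => i _; have /negPn/eqP -> := z i; rewrite mul0rn mulr0.
have := @msize_mdeg_lt _ _ p (m + U_(i)); rewrite mcoeff_msupp => /(_ pmi).
by rewrite mdegD mdeg1 addn1; case: (msize p).
Qed.

Lemma msize_dderivs vs p : (msize (dderivs vs p) <= msize p - size vs)%N.
Proof.
elim: vs => [|v vs ih] /=; first by rewrite subn0.
apply: leq_trans (msize_dderiv _ _) _; rewrite subnS; move: ih.
by case: (msize _) => //= a; case: (_ - _)%N.
Qed.

Definition mfact (m : 'X_{1..n}) : nat := \prod_i (m i)`!.

Lemma mfactD1 m i : mfact (m + U_(i)) = ((m i).+1 * mfact m)%N.
Proof.
rewrite /mfact [LHS](bigD1 i) //= [in RHS](bigD1 i) //= mulnA.
rewrite mnmDE mnm1E eqxx addn1 factS; congr (_ * _)%N; apply: eq_bigr => j ji.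
by rewrite mnmDE mnm1E eq_sym (negbTE ji) addn0.
Qed.

(** The squared Fischer norm. On forms of degree k it is k! times the squared Bombieri-Weyl norm,
    but its weights do not depend on the degree. *)
Definition sqfischer p : R :=
  \sum_(m <- msupp p) normc p@_m ^+ 2 * (mfact m)%:R.

Lemma sqfischer_ge0 p : 0 <= sqfischer p.
Proof. by apply: sumr_ge0 => m _; rewrite mulr_ge0 ?sqr_ge0. Qed.

Lemma mcoeff_sqfischer p m : normc p@_m ^+ 2 * (mfact m)%:R <= sqfischer p.
Proof.
have [mp|] := boolP (m \in msupp p).
  rewrite /sqfischer (big_rem m) //= lerDl sumr_ge0 // => m' _.
  by rewrite mulr_ge0 ?sqr_ge0.
rewrite mcoeff_msupp negbK => /eqP ->.
by rewrite Normc.normc0 expr0n mul0r sqfischer_ge0.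
Qed.

(** Cauchy-Schwarz bounds each coefficient of the derivative. Since (m + U_i)! = (m_i + 1) m!, each
    monomial m of [p] is then counted with total weight at most the sum of the m_i, which is deg m
    <= k. *)
Lemma sqfischer_dderiv k v p : (msize p <= k.+1)%N ->
  sqfischer (dderiv v p) <= k%:R * hnorm v ^+ 2 * sqfischer p.
Proof.
move=> pk; pose F m := normc p@_m ^+ 2 * (mfact m)%:R.
have F0 m : 0 <= F m by rewrite mulr_ge0 ?sqr_ge0.
apply: (@le_trans _ _ (\sum_(m <- msupp (dderiv v p))
    hnorm v ^+ 2 * \sum_i ((m + U_(i))%MM i)%:R * F (m + U_(i))%MM)).
  apply: ler_sum => m _.
  rewrite mcoeff_dderiv; under eq_bigr do rewrite mulrC.
  apply: le_trans (ler_wpM2r _ (normc_dot_le _ _)) _ => //.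
  rewrite mulrAC mulrC ler_wpM2l ?sqr_ge0 // mulr_suml; apply: ler_sum => i _.
  rewrite /F mfactD1 mnmDE mnm1E eqxx addn1 natrM normcMn.
  by rewrite -mulr_natr le_eqVlt; apply/orP; left; apply/eqP; ring.
rewrite -mulr_sumr [leRHS]mulrAC [leRHS]mulrC ler_wpM2l ?sqr_ge0 // exchange_big /=.
apply: (@le_trans _ _ (\sum_i \sum_(m <- msupp p) (m i)%:R * F m)).
  apply: ler_sum => i _; rewrite -(big_map (fun m => (m + U_(i))%MM) predT
    (fun m : 'X_{1..n} => (m i)%:R * F m)).
  apply: sum_subset_le => [|||m _].
  - by rewrite map_inj_uniq ?msupp_uniq // => m m' /addIm.
  - exact: msupp_uniq.
  - by move=> m; rewrite mulr_ge0.
  - apply: contraNT; rewrite mcoeff_msupp negbK => /eqP pm.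
    by rewrite /F pm Normc.normc0 expr0n mul0r mulr0.
rewrite exchange_big mulr_sumr /= [leRHS]big_seq big_seq.
apply: ler_sum => m mp; rewrite -mulr_suml -natr_sum -mdegE ler_wpM2r //.
by rewrite ler_nat -ltnS (leq_trans _ pk) // msize_mdeg_lt.
Qed.

(** [r] bounds the degree left after all derivatives; the degree factors of the single steps
    multiply up to (size vs + r)! / r!. *)
Lemma sqfischer_dderivs r vs p : (msize p <= (size vs + r).+1)%N ->
  (r`!)%:R * sqfischer (dderivs vs p) <=
  ((size vs + r)`!)%:R * (\prod_(v <- vs) hnorm v) ^+ 2 * sqfischer p.
Proof.
elim: vs r => [|v vs ih] r /= pr; first by rewrite big_nil expr1n mulr1.
have /ih {ih} : (msize p <= (size vs + r.+1).+1)%N by rewrite addnS -addSn.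
rewrite addSnnS big_cons => ih.
have /sqfischer_dderiv h : (msize (dderivs vs p) <= r.+2)%N.
  by apply: leq_trans (msize_dderivs _ _) _; rewrite leq_subLR addnS -addSnnS.
apply: le_trans (ler_wpM2l _ (h v)) _ => //.
move: (ler_wpM2l (sqr_ge0 (hnorm v)) ih); rewrite factS natrM; lra.
Qed.

(** The case [r = 0]; the constant coefficient has weight 1 in the Fischer norm. *)
Lemma normc_dderivs0 vs p : (msize p <= (size vs).+1)%N ->
  normc (dderivs vs p)@_0%MM ^+ 2 <=
  ((size vs)`!)%:R * (\prod_(v <- vs) hnorm v) ^+ 2 * sqfischer p.
Proof.
move=> pk; have := @sqfischer_dderivs 0 vs p; rewrite addn0 mul1r => /(_ pk).
apply: le_trans; have := mcoeff_sqfischer (dderivs vs p) 0%MM.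
by rewrite /mfact big1 ?mulr1 // => i _; rewrite mnm0E.
Qed.

End FischerNorm.

(** * Higher derivatives as forms *)

Section HigherDerivatives.
Variables (R : realType) (n : nat).
Local Notation C := R[i].
Local Notation normc := Normc.normc.
Implicit Types (p q : {mpoly C[n]}) (v z : 'cV[C]_n) (vs : seq 'cV[C]_n).

Lemma peval_sum z (I : finType) (c : I -> C) (p : I -> {mpoly C[n]}) :
  peval (\sum_i c i *: p i) z = \sum_i c i * peval (p i) z.
Proof.
rewrite /peval (raddf_sum (meval (fun i => z i 0))).
by apply: eq_bigr => i _; rewrite /= mevalZ.
Qed.

Lemma dderivs_dderiv v vs p :
  dderivs vs (dderiv v p) = dderiv v (dderivs vs p).
Proof.
elim: vs => [//|w vs ih].
by rewrite -[LHS]/(dderiv w (dderivs vs _)) ih dderivC.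
Qed.

Lemma foldr_mderiv i (s : seq 'I_n) p :
  foldr (fun i q => q^`M(i)) p^`M(i) s = (foldr (fun i q => q^`M(i)) p s)^`M(i).
Proof. by elim: s => [//|j s ih]; rewrite [LHS]/= ih mderiv_comm. Qed.

Lemma derivative_mpoly0 p z : derivative_mpoly 0 p z = (peval p z)%:MP.
Proof.
rewrite /derivative_mpoly (bigD1 [tuple]) //= big_nil big1 ?addr0 => [|t].
  by rewrite -mul_mpolyC mulr1.
by move/eqP; case; apply: tuple0.
Qed.

(** Splitting off the first index of the tuple gives a recursion on k that carries the inductions
    below. *)
Lemma derivative_mpolyS k p z :
  derivative_mpoly k.+1 p z = \sum_i 'X_i * derivative_mpoly k p^`M(i) z.
Proof.
under eq_bigr do rewrite /derivative_mpoly mulr_sumr.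
rewrite pair_big /= /derivative_mpoly.
rewrite (reindex (fun u : 'I_n * k.-tuple 'I_n => [tuple of u.1 :: u.2])).
  apply: eq_bigr => -[i t] _ /=; rewrite big_cons foldr_mderiv.
  by rewrite scalerAr.
exists (fun t => (thead t, [tuple of behead t])) => [[i t] _|t _] /=.
  by congr (_, _); apply: val_inj.
by rewrite -tuple_eta.
Qed.

Lemma derivative_mpoly_sum k z (I : finType) (c : I -> C)
    (p : I -> {mpoly C[n]}) :
  derivative_mpoly k (\sum_i c i *: p i) z =
  \sum_i c i *: derivative_mpoly k (p i) z.
Proof.
elim: k p => [|k ih] p.
  rewrite derivative_mpoly0 peval_sum raddf_sum; apply: eq_bigr => i _ /=.
  by rewrite derivative_mpoly0 mpolyCM mul_mpolyC.
under [RHS]eq_bigr do rewrite derivative_mpolyS scaler_sumr.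
rewrite exchange_big derivative_mpolyS; apply: eq_bigr => j _ /=.
rewrite (raddf_sum (mderiv j)) /=.
under eq_bigr do rewrite mderivZ.
by rewrite ih mulr_sumr; apply: eq_bigr => i _; rewrite -scalerAr.
Qed.

Lemma mderivXU i j : ('X_j : {mpoly C[n]})^`M(i) = (j == i)%:R.
Proof.
rewrite mderivX mnm1E; case: eqP => [->|_]; last by rewrite scale0r.
by rewrite -{1}[U_(i)%MM]add0m addmK mpolyX0 scale1r.
Qed.

(** Product rule on this recursion: differentiating the factor ['X_i] gives one copy, the induction
    hypothesis all the others. *)
Lemma mderiv_derivative_mpoly k p z i :
  (derivative_mpoly k.+1 p z)^`M(i) = derivative_mpoly k p^`M(i) z *+ k.+1.
Proof.
elim: k p => [|k ih] p; rewrite derivative_mpolyS (raddf_sum (mderiv i)) /=.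
  rewrite (bigD1 i) //= big1 => [|j ji].
    by rewrite mderivM !derivative_mpoly0 mderivC mulr0 mderivXU eqxx mul1r !addr0.
  by rewrite mderivM derivative_mpoly0 mderivC mulr0 mderivXU (negbTE ji) mul0r addr0.
under eq_bigr do rewrite mderivM ih mderiv_comm mulrnAr.
rewrite big_split sumrMnl /= -derivative_mpolyS [RHS]mulrS; congr (_ + _).
rewrite (bigD1 i) //= big1 => [|j ji].
  by rewrite mderivXU eqxx mul1r addr0.
by rewrite mderivXU (negbTE ji) mul0r.
Qed.

Lemma dderiv_derivative_mpoly k p z v :
  dderiv v (derivative_mpoly k.+1 p z) = derivative_mpoly k (dderiv v p) z *+ k.+1.
Proof.
rewrite derivative_mpoly_sum -sumrMnl; apply: eq_bigr => i _.
by rewrite mderiv_derivative_mpoly scalerMnr.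
Qed.

(** Polarization: k directional derivatives of the form v |-> D^k p(z)(v, ..., v) return k! times
    the symmetric multilinear form. *)
Lemma dderivs_derivative_mpoly vs p z :
  dderivs vs (derivative_mpoly (size vs) p z) =
  (peval (dderivs vs p) z *+ (size vs)`!)%:MP.
Proof.
elim: vs p => [|v vs ih] p; first by rewrite derivative_mpoly0.
rewrite -[LHS]/(dderiv v (dderivs vs _)) -dderivs_dderiv.
rewrite dderiv_derivative_mpoly raddfMn /= ih dderivs_dderiv factS mulnC.
by rewrite mulrnA [RHS]raddfMn.
Qed.

Lemma derivative_mpoly_eq0 k p z : (msize p <= k)%N -> derivative_mpoly k p z = 0.
Proof.
move=> pk; rewrite /derivative_mpoly big1 // => t _.
have -> : foldr (fun i q => q^`M(i)) p t =
    dderivs [seq delta_mx i 0 | i <- t] p.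
  by elim: (val t) => //= i s ->; rewrite dderiv_delta.
have -> : dderivs [seq delta_mx i 0 | i <- t] p = 0.
  apply/eqP; rewrite -msize_poly_eq0 -leqn0.
  by apply: leq_trans (msize_dderivs _ _) _; rewrite size_map size_tuple leq_subLR addn0.
by rewrite /peval meval0 scale0r.
Qed.

End HigherDerivatives.

(** * The Bombieri-Weyl norm and its dual on symmetric powers *)

Section SymmetricPowerNorms.
Variables (R : realType) (n k : nat).
Local Notation C := R[i].
Local Notation normc := Normc.normc.
Implicit Types (p q : dhomog n C k) (s : sym_power R n k).

Lemma sqr_form_norm p : form_norm p ^+ 2 = sqfischer p / (k`!)%:R.
Proof.
rewrite sqr_sqrtr.
  rewrite /sqfischer mulr_suml; apply: eq_bigr => m _.
  by rewrite invf_div mulrA.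
apply: sumr_ge0 => m _; by rewrite mulr_ge0 ?sqr_ge0 // invr_ge0 divr_ge0.
Qed.

Lemma sqfischer_form_norm p :
  sqfischer p = form_norm p ^+ 2 * (k`!)%:R.
Proof. by rewrite sqr_form_norm divfK // pnatr_eq0 -lt0n fact_gt0. Qed.

Lemma form_norm_ge0 p : 0 <= form_norm p.
Proof. exact: sqrtr_ge0. Qed.

Lemma form_norm0 : form_norm (0 : dhomog n C k) = 0.
Proof. by rewrite /form_norm msupp0 big_nil sqrtr0. Qed.

Lemma sqfischerZ c (p : {mpoly C[n]}) :
  sqfischer (c *: p) = normc c ^+ 2 * sqfischer p.
Proof.
have [->|c0] := eqVneq c 0.
  by rewrite scale0r Normc.normc0 expr0n mul0r /sqfischer msupp0 big_nil.
rewrite /sqfischer (perm_big _ (msuppZ _ c0)) mulr_sumr; apply: eq_bigr => m _.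
by rewrite mcoeffZ Normc.normcM exprMn mulrA.
Qed.

Lemma form_normZ c p : form_norm (c *: p) = normc c * form_norm p.
Proof.
apply/(@pexpIrn _ 2); rewrite ?nnegrE ?mulr_ge0 ?normc_ge0 ?form_norm_ge0 //.
by rewrite exprMn !sqr_form_norm linearZ /= sqfischerZ mulrA.
Qed.

(** Expands [p] over finitely many monomials, so that a linear functional is controlled by its
    values on them. Monomials of degree other than k have coefficient 0. *)
Lemma dhomog_monomials p :
  p = \sum_(m : 'X_{1..n < k.+1}) (val p)@_m *: indhomog k 'X_[m].
Proof.
apply: val_inj; rewrite [LHS](mpolywE (k := k.+1)).
  rewrite (raddf_sum (@mpoly_of_dhomog n C k)); apply: eq_bigr => m _.
  rewrite -[RHS]/((val p)@_m *: val (indhomog k 'X_[m])) val_insubd dhomogX.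
  case: eqVneq => [//|mk].
  by rewrite (dhomog_nemf_coeff (dhomog_is_dhomog p) mk) !scale0r.
rewrite msizeE; apply/bigmax_leqP_seq => m mp _.
by rewrite ltnS (dhomog_mf (dhomog_is_dhomog p)).
Qed.

(** The weights m! / k! are at least 1 / k!, so the squared coefficient is at most k! <= (k!)^2.
    This crude bound serves the finiteness of the suprema. *)
Lemma normc_mcoeff_le p m : form_norm p <= 1 -> normc (val p)@_m <= (k`!)%:R.
Proof.
move=> p1; have k1 : 1 <= (k`!)%:R :> R by rewrite ler1n fact_gt0.
rewrite -(@ler_pXn2r _ 2) ?nnegrE ?normc_ge0 //.
have m1 : 1 <= (mfact m)%:R :> R by rewrite ler1n prodn_gt0 // => i; apply: fact_gt0.
have p2 : form_norm p ^+ 2 <= 1 by rewrite exprn_ile1 ?form_norm_ge0.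
apply: le_trans (ler_peMr (sqr_ge0 _) m1) _.
apply: le_trans (mcoeff_sqfischer _ _) _; rewrite sqfischer_form_norm expr2.
by apply: ler_wpM2r => //; apply: le_trans k1.
Qed.

Lemma sym_power_norm_ubound s :
  has_ubound [set normc (s p) | p in [set p | form_norm p <= 1]].
Proof.
exists (\sum_(m : 'X_{1..n < k.+1}) (k`!)%:R * normc (s (indhomog k 'X_[m]))).
move=> _ [p /= p1 <-]; rewrite [p]dhomog_monomials linear_sum.
apply: le_trans (normc_sum _ _ _) _; apply: ler_sum => m _.
by rewrite linearZ Normc.normcM ler_wpM2r ?normc_ge0 ?normc_mcoeff_le.
Qed.

Lemma normc_sym_power_le s p :
  sym_power_norm s <= 1 -> normc (s p) <= form_norm p + 1.
Proof.
(* Dividing by [form_norm p + 1] brings [p] into the unit ball even if [form_norm p] is 0. *)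
move=> s1; set c := (form_norm p + 1)^-1.
have c0 : 0 < c by rewrite invr_gt0 ltr_wpDl ?form_norm_ge0.
suff : normc (s ((c%:C)%C *: p)) <= 1.
  rewrite linearZ Normc.normcM (normc_real (ltW c0)) => cs.
  by rewrite -[leRHS]invrK -/c -[leRHS]mulr1 ler_pdivlMl.
apply: le_trans s1; apply: ub_le_sup; first exact: sym_power_norm_ubound.
exists ((c%:C)%C *: p) => //=; rewrite form_normZ (normc_real (ltW c0)).
by rewrite mulrC ler_pdivrMr ?mul1r ?lerDl // ltr_wpDl ?form_norm_ge0.
Qed.

End SymmetricPowerNorms.

(** * The bounds given by gamma *)

Section Gamma.
Variables (R : realType) (n : nat).
Local Notation C := R[i].
Local Notation normc := Normc.normc.
Implicit Types (g : 'I_n -> {mpoly C[n]}) (v z : 'cV[C]_n) (vs : seq 'cV[C]_n).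

Definition sderivs g vs z : 'cV[C]_n := \col_i peval (dderivs vs (g i)) z.

Section DualNorm.
Variable k : nat.

(* For [size vs = k], the multiple by [c * k!] of the symmetric product of [vs],
   as a functional on forms of degree k. *)
Definition sym_product c vs (p : dhomog n C k) : C^o := c * (dderivs vs p)@_0%MM.

Lemma sym_product_is_linear c vs : linear (sym_product c vs).
Proof.
move=> a p q; rewrite /sym_product !linearP /= mulrDr; congr (_ + _).
by rewrite [RHS]mulrCA.
Qed.

HB.instance Definition _ c vs :=
  GRing.isLinear.Build C (dhomog n C k) C^o _ (sym_product c vs)
    (sym_product_is_linear c vs).

(** As [sqfischer p] is k! times the squared form norm, the factor k! of [normc_dderivs0] becomes
    (k!)^2, and square roots can be taken. *)
Lemma normc_sym_product_le c vs (p : dhomog n C k) : size vs = k ->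
  normc (sym_product c vs p) <=
  normc c * ((k`!)%:R * \prod_(v <- vs) hnorm v) * form_norm p.
Proof.
move=> vsk; rewrite Normc.normcM -mulrA ler_wpM2l ?normc_ge0 //.
have P0 : 0 <= \prod_(v <- vs) hnorm v.
  by apply: prodr_ge0 => v _; apply: hnorm_ge0.
rewrite -(@ler_pXn2r _ 2) ?nnegrE ?mulr_ge0 ?normc_ge0 ?form_norm_ge0 //.
apply: le_trans (normc_dderivs0 _) _.
  rewrite vsk msizeE; apply/bigmax_leqP_seq => m mp _.
  by rewrite ltnS (dhomog_mf (dhomog_is_dhomog p) mp).
by rewrite vsk sqfischer_form_norm le_eqVlt; apply/orP; left; apply/eqP; ring.
Qed.

Lemma sym_power_norm_product_le c vs : size vs = k ->
  normc c * ((k`!)%:R * \prod_(v <- vs) hnorm v) <= 1 ->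
  @sym_power_norm R n k (sym_product c vs) <= 1.
Proof.
move=> vsk c1; apply: ge_sup => [|_ [p /= p1 <-]].
  by exists (normc (sym_product c vs 0)); exists 0; rewrite //= form_norm0.
apply: le_trans (normc_sym_product_le _ _ vsk) _.
apply: le_trans (ler_wpM2r (form_norm_ge0 _) c1) _; by rewrite mul1r.
Qed.

Definition newton_derivative g z (s : sym_power R n k) : 'cV[C]_n :=
  (k`!)%:R^-1 *: (invmx (jacobian g z) *m derivative_map g z s).

(** The k! produced by polarization cancels the 1 / k! of [newton_derivative]. *)
Lemma newton_derivative_product g z c vs : size vs = k ->
  newton_derivative g z (sym_product c vs) =
  c *: (invmx (jacobian g z) *m sderivs g vs z).
Proof.
move=> vsk; rewrite /newton_derivative 2!scalemxAr; congr (_ *m _).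
apply/matrixP => i j; rewrite !mxE.
rewrite -[X in _ * X]/(c * (dderivs vs (derivative_form k (g i) z))@_0%MM).
have -> : dderivs vs (derivative_form k (g i) z) =
    (peval (dderivs vs (g i)) z *+ k`!)%:MP.
  by rewrite -[mpoly_of_dhomog _]/(derivative_mpoly k (g i) z) -vsk
    dderivs_derivative_mpoly.
rewrite mcoeffC eqxx mulr1 -[peval _ _ *+ _]mulr_natr mulrCA.
congr (_ * _); rewrite [LHS]mulrC mulfK // pnatr_eq0 -lt0n; exact: fact_gt0.
Qed.

Lemma hnorm_mulmx_le (A : 'M[C]_n) v :
  hnorm (A *m v) <= \sum_i \sum_j normc (A i j) * normc (v j 0).
Proof.
apply: le_trans (hnorm_le_sum _) _; apply: ler_sum => i _; rewrite mxE.
apply: le_trans (normc_sum _ _ _) _; apply: ler_sum => j _.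
by rewrite Normc.normcM.
Qed.

Lemma sym_operator_norm_ubound g z :
  has_ubound [set hnorm (newton_derivative g z s) |
    s in [set s | sym_power_norm s <= 1]].
Proof.
exists (normc (k`!)%:R^-1 * \sum_i \sum_j normc (invmx (jacobian g z) i j) *
  (form_norm (derivative_form k (g j) z) + 1)).
move=> _ [s /= s1 <-]; rewrite hnorm_scale ler_wpM2l ?normc_ge0 //.
apply: le_trans (hnorm_mulmx_le _ _) _; apply: ler_sum => i _.
apply: ler_sum => j _; rewrite ler_wpM2l ?normc_ge0 // mxE.
exact: normc_sym_power_le.
Qed.

(** [sym_product 0 [::]] is the zero functional for every k; it witnesses that the dual unit ball is
    nonempty. *)
Lemma sym_power_norm_product0 : @sym_power_norm R n k (sym_product 0 [::]) <= 1.
Proof.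
apply: ge_sup => [|_ [p /= p1 <-]].
  by exists (normc (sym_product 0 [::] 0)); exists 0; rewrite //= form_norm0.
by rewrite /sym_product mul0r Normc.normc0.
Qed.

Lemma sym_operator_norm_ge0 g z : 0 <= sym_operator_norm (newton_derivative g z).
Proof.
apply: le_trans (hnorm_ge0 (newton_derivative g z (sym_product 0 [::]))) _.
apply: ub_le_sup; first exact: sym_operator_norm_ubound.
by eexists; first exact: sym_power_norm_product0.
Qed.

(** With c the inverse of k! |v_1| ... |v_k|, the functional [sym_product c vs] lies in the dual
    unit ball and so tests the operator norm. *)
Lemma hnorm_sderivs_le g z vs : size vs = k ->
  hnorm (invmx (jacobian g z) *m sderivs g vs z) <=
  (k`!)%:R * sym_operator_norm (newton_derivative g z) * \prod_(v <- vs) hnorm v.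
Proof.
move=> vsk; set P := \prod_(v <- vs) _; set H := hnorm _.
have P0 : 0 <= P by apply: prodr_ge0 => v _; apply: hnorm_ge0.
have k0 : 0 < (k`!)%:R :> R by rewrite ltr0n fact_gt0.
have L (c : R) : 0 <= c -> c * ((k`!)%:R * P) <= 1 ->
    c * H <= sym_operator_norm (newton_derivative g z).
  move=> c0 c1; rewrite -[c](normc_real c0) -hnorm_scale -newton_derivative_product //.
  apply: ub_le_sup; first exact: sym_operator_norm_ubound.
  exists (sym_product (c%:C)%C vs) => //=; apply: sym_power_norm_product_le => //.
  by rewrite normc_real.
(* If some direction is 0, every c >= 0 is admissible in [L]; for [H > 0] the choice c = (|S| + 1) /
   H would give |S| + 1 <= S. *)
have [P_0|Pn0] := eqVneq P 0.
  rewrite P_0 mulr0; have H0 : 0 <= H by apply: hnorm_ge0.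
  have [//|Hp] := leP H 0; set S := sym_operator_norm _ in L.
  have := L ((`|S| + 1) / H); rewrite P_0 !mulr0 divfK ?gt_eqF // => /(_ _ ler01).
  rewrite divr_ge0 // ?addr_ge0 // => /(_ isT); have := ler_norm S; lra.
have Pp : 0 < P by rewrite lt_def Pn0.
have kP : 0 < (k`!)%:R * P by rewrite mulr_gt0.
have := L ((k`!)%:R * P)^-1; rewrite mulVf ?gt_eqF // invr_ge0 (ltW kP).
move=> /(_ isT (lexx _)); rewrite ler_pdivrMl //; lra.
Qed.

End DualNorm.

Lemma gamma_term_ge0 g z k : 0 <= gamma_term g z k.
Proof. exact: powR_ge0. Qed.

Lemma gamma_term_eq0 g z k : (1 < k)%N -> (forall i, msize (g i) <= k)%N ->
  gamma_term g z k = 0.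
Proof.
move=> k1 gk; rewrite /gamma_term.
have -> : sym_operator_norm (newton_derivative (k := k) g z) = 0.
  apply/eqP; rewrite eq_le sym_operator_norm_ge0 andbT; apply: ge_sup.
    by eexists; eexists; first exact: sym_power_norm_product0.
  move=> _ [s _ <-]; rewrite /newton_derivative.
  have -> : derivative_map g z s = 0.
    apply/matrixP => i j; rewrite !mxE.
    have -> : derivative_form k (g i) z = 0.
      by apply: val_inj; apply: derivative_mpoly_eq0.
    by rewrite linear0.
  by rewrite mulmx0 scaler0 hnorm0.
(* The real power 0^0 is 1, so the exponent 1 / (k - 1) has to be nonzero; here [1 < k] enters. *)
by rewrite powR0 // invr_eq0 pnatr_eq0; case: k k1 {gk} => [|[]].
Qed.

(** The terms with k at least the largest [msize] vanish, so the sum of the earlier ones bounds the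
    set whose supremum is [gamma]. *)
Lemma gamma_term_le g z k : (1 < k)%N -> gamma_term g z k <= gamma g z.
Proof.
move=> k1; apply: ub_le_sup; last by exists k.
pose K := (\max_i msize (g i))%N.
exists (\sum_(j < K) gamma_term g z j) => _ [j j1 <-].
have [jK|Kj] := ltnP j K.
  rewrite (bigD1 (Ordinal jK)) //= lerDl sumr_ge0 // => i _.
  exact: gamma_term_ge0.
rewrite gamma_term_eq0 ?sumr_ge0 // => [i _|i]; first exact: gamma_term_ge0.
by apply: leq_trans Kj; apply: (leq_bigmax i).
Qed.

Lemma gamma_ge0 g z : 0 <= gamma g z.
Proof. by apply: le_trans (gamma_term_le _ _ (ltnSn 1)); apply: gamma_term_ge0. Qed.

(** Raising to the power k - 1 undoes the root taken in [gamma_term]. *)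
Lemma sderivs_gamma_le g z vs : (1 < size vs)%N ->
  hnorm (invmx (jacobian g z) *m sderivs g vs z) <=
  ((size vs)`!)%:R * gamma g z ^+ (size vs).-1 * \prod_(v <- vs) hnorm v.
Proof.
move=> vs1; apply: le_trans (hnorm_sderivs_le _ _ erefl) _.
rewrite ler_wpM2r //; first by apply: prodr_ge0 => v _; apply: hnorm_ge0.
rewrite ler_wpM2l //; set S := sym_operator_norm _.
have <- : gamma_term g z (size vs) ^+ (size vs).-1 = S.
  rewrite -powR_mulrn ?powR_ge0 // -powRrM mulVf ?powRr1 //.
    exact: sym_operator_norm_ge0.
  by rewrite pnatr_eq0; case: (size vs) vs1 => [|[]].
by rewrite lerXn2r ?nnegrE ?gamma_ge0 ?gamma_term_ge0 ?gamma_term_le.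
Qed.

End Gamma.

(** * Taylor expansion *)

Section Taylor.
Variables (R : realType) (n : nat).
Local Notation C := R[i].
Local Notation normc := Normc.normc.
Implicit Types (p q : {mpoly C[n]}) (g : 'I_n -> {mpoly C[n]}).
Implicit Types (x v z : 'cV[C]_n) (vs : seq 'cV[C]_n).

(** The restriction of [p] to the line t |-> x + t v, which reduces Taylor's formula to one
    variable. *)
Definition line_poly x v p : {poly C} :=
  mmap (@polyC C) (fun i => (x i 0)%:P + v i 0 *: 'X) p.

Lemma horner_line_poly x v p t :
  (line_poly x v p).[t] = peval p (x + t *: v).
Proof.
rewrite /line_poly /mmap /mmap1 horner_sum /peval mevalE; apply: eq_bigr => m _.
rewrite hornerM hornerC horner_prod; congr (_ * _); apply: eq_bigr => i _.
by rewrite horner_exp !mxE !hornerE mulrC.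
Qed.

Lemma dderivM v p q : dderiv v (p * q) = dderiv v p * q + p * dderiv v q.
Proof.
rewrite /dderiv mulr_suml mulr_sumr -big_split; apply: eq_bigr => i _ /=.
by rewrite mderivM scalerDr scalerAl scalerAr.
Qed.

(** Chain rule: both sides are linear in [p], and the identity holds for 1 and the variables and
    passes to products. *)
Lemma deriv_line_poly x v p :
  (line_poly x v p)^`() = line_poly x v (dderiv v p).
Proof.
pose Q p := (line_poly x v p)^`() = line_poly x v (dderiv v p).
have Q1 : Q 1.
  rewrite /Q /line_poly rmorph1 derivC /dderiv big1 ?rmorph0 // => i _.
  by rewrite -mpolyC1 mderivC scaler0.
have QM p1 p2 : Q p1 -> Q p2 -> Q (p1 * p2).
  rewrite /Q => h1 h2; rewrite dderivM /line_poly rmorphD !rmorphM derivM.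
  by rewrite -!/(line_poly x v _) h1 h2.
have QX i : Q 'X_i.
  rewrite /Q /line_poly mmapX mmap1U derivD derivC add0r derivZ derivX.
  rewrite /dderiv (bigD1 i) //= mderivXU eqxx big1 => [|j ji].
    by rewrite addr0 mmapZ rmorph1 mulr1 alg_polyC.
  by rewrite mderivXU eq_sym (negbTE ji) scaler0.
have QXm m : Q 'X_[m].
  rewrite mpolyXE_id; apply: (big_ind Q Q1 QM) => i _.
  elim: (m i) => [|k ih]; first exact: Q1.
  by rewrite exprS; apply: QM; first exact: QX.
rewrite [p]mpolyE (raddf_sum (dderiv v)) /line_poly.
rewrite !(raddf_sum (mmap (@polyC C) (fun i => (x i 0)%:P + v i 0 *: 'X))).
rewrite raddf_sum; apply: eq_bigr => m _ /=.
rewrite linearZ /= !mmapZ derivM derivC mul0r add0r.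
by congr (_ * _); apply: QXm.
Qed.

Lemma derivn_line_poly x v p k :
  (line_poly x v p)^`(k) = line_poly x v (dderivs (nseq k v) p).
Proof. by elim: k => [//|k ih]; rewrite derivnS ih deriv_line_poly. Qed.

Lemma peval_taylor x v p L : (size (line_poly x v p) <= L)%N ->
  peval p (x + v) =
  \sum_(k < L) (k`!)%:R^-1 * peval (dderivs (nseq k v) p) x.
Proof.
move=> pL; rewrite -[v in LHS]scale1r -horner_line_poly -[1 in LHS]add0r.
rewrite (nderiv_taylor_wide (mulrC _ _) pL); apply: eq_bigr => k _.
rewrite expr1n mulr1 -[x in RHS]addr0 -[0 in RHS](scale0r v) -horner_line_poly.
by rewrite -derivn_line_poly nderivn_def hornerMn -[_.[0] *+ _]mulr_natl mulKf //.
Qed.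

(** Every [L] from [L0] on is allowed, so that [L] can be taken large enough to split off the first
    terms. *)
Lemma sderivs_taylor g vs x v : exists L0, forall L, (L0 <= L)%N ->
  sderivs g vs (x + v) =
  \sum_(0 <= k < L) (k`!)%:R^-1 *: sderivs g (nseq k v ++ vs) x.
Proof.
exists (\max_i size (line_poly x v (dderivs vs (g i))))%N => L L0.
apply/matrixP => i j; rewrite summxE mxE (@peval_taylor _ _ _ L); last first.
  by apply: leq_trans L0; apply: (leq_bigmax i).
by rewrite big_mkord; apply: eq_bigr => k _; rewrite !mxE /dderivs foldr_cat.
Qed.

Lemma sderivs_nil g x : sderivs g [::] x = seval g x.
Proof. by []. Qed.

Lemma sderivs1 g v x : sderivs g [:: v] x = jacobian g x *m v.
Proof.
apply/matrixP => i j; rewrite !mxE (ord1 j) /= /dderiv peval_sum.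
by apply: eq_bigr => k _; rewrite mxE mulrC.
Qed.

End Taylor.

(** Partial sums S_k of the binomial series. Pascal's rule gives (1 - u) S_{k+1} <= S_k, with an
    inequality because of the truncation. *)
Lemma sum_bin_expr_le (R : realFieldType) (u : R) k L : 0 <= u -> u < 1 ->
  \sum_(0 <= l < L) 'C(l + k, l)%:R * u ^+ l <= ((1 - u) ^+ k.+1)^-1.
Proof.
move=> u0 u1; have w0 : 0 < 1 - u by lra.
pose S k L := \sum_(0 <= l < L) 'C(l + k, l)%:R * u ^+ l.
have S0 k' L' : 0 <= S k' L'.
  by apply: sumr_ge0 => l _; rewrite mulr_ge0 ?exprn_ge0.
rewrite -[leRHS]mul1r ler_pdivlMr ?exprn_gt0 // -/(S k L).
elim: k => [|k ih].
  have : S 0%N L * (1 - u) = 1 - u ^+ L.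
    elim: L => [|L ihL]; first by rewrite /S big_nil mul0r subrr.
    by rewrite /S big_nat_recr //= -/(S 0%N L) mulrDl ihL addn0 binn exprS; ring.
  by rewrite expr1 => ->; rewrite gerBl exprn_ge0.
apply: le_trans ih; rewrite exprS mulrA.
apply: ler_wpM2r; first by rewrite exprn_ge0 // ltW.
suff : S k.+1 L <= S k L + u * S k.+1 L by lra.
case: L => [|L]; first by rewrite /S !big_nil mulr0 addr0.
rewrite {1 2}/S !big_nat_recl //= !bin0 -addrA lerD2l.
apply: (@le_trans _ _ (\sum_(0 <= l < L) ('C(l.+1 + k, l.+1)%:R * u ^+ l.+1 +
    u * ('C(l + k.+1, l)%:R * u ^+ l)))).
  apply: ler_sum => l _; rewrite addSn binS natrD -addSnnS addSn exprS.
  by rewrite le_eqVlt; apply/orP; left; apply/eqP; ring.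
rewrite big_split /= lerD2l -mulr_sumr ler_wpM2l // /S big_nat_recr //= lerDl.
by rewrite mulr_ge0 ?exprn_ge0.
Qed.

(** * One Newton step *)

Section NewtonStep.
Variables (R : realType) (n : nat).
Local Notation C := R[i].
Local Notation normc := Normc.normc.
Implicit Types (g : 'I_n -> {mpoly C[n]}) (x v z : 'cV[C]_n) (vs : seq 'cV[C]_n).

(** A free constant [c] replaces [gamma], so that the bounds can be carried to the next iterate with
    an explicit new constant. *)
Definition derivs_bounded g x (c : R) := forall vs, (1 < size vs)%N ->
  hnorm (invmx (jacobian g x) *m sderivs g vs x) <=
  ((size vs)`!)%:R * c ^+ (size vs).-1 * \prod_(v <- vs) hnorm v.

(** With k = [size vs], (l + k)! / l! = k! C(l + k, l). The condition on [j] makes every derivative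
    in the tail of order at least 2, as [derivs_bounded] requires. *)
Lemma taylor_tail_le g x c v vs j L :
  derivs_bounded g x c -> (1 < j + size vs)%N ->
  hnorm (invmx (jacobian g x) *m
    \sum_(j <= l < L) (l`!)%:R^-1 *: sderivs g (nseq l v ++ vs) x) <=
  ((size vs)`!)%:R * (\prod_(w <- vs) hnorm w) *
  \sum_(j <= l < L) 'C(l + size vs, l)%:R *
    (c ^+ (l + size vs).-1 * hnorm v ^+ l).
Proof.
move=> gc j1; rewrite mulmx_sumr mulr_sumr; apply: le_trans (hnorm_sum _ _ _) _.
rewrite big_nat [leRHS]big_nat; apply: ler_sum => l /andP[jl _].
rewrite -scalemxAr hnorm_scale Normc.normcV normc_nat.
have l0 : 0 < (l`!)%:R :> R by rewrite ltr0n fact_gt0.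
rewrite ler_pdivrMl //; apply: le_trans (gc _ _) _.
  by rewrite size_cat size_nseq (leq_trans j1) // leq_add2r.
rewrite size_cat size_nseq big_cat big_nseq /= iter_mulr_1.
rewrite -(bin_fact (leq_addr (size vs) l)) addKn !natrM.
by rewrite le_eqVlt; apply/orP; left; apply/eqP; ring.
Qed.

Lemma sum_bin_newton_le (c b : R) k L : 0 <= c -> 0 <= b -> c * b < 1 ->
  \sum_(0 <= l < L) 'C(l + k.+1, l)%:R * (c ^+ (l + k.+1).-1 * b ^+ l) <=
  c ^+ k / (1 - c * b) ^+ k.+2.
Proof.
move=> c0 b0 cb; have cb0 := mulr_ge0 c0 b0.
apply: le_trans (ler_wpM2l (exprn_ge0 k c0) (sum_bin_expr_le k.+1 L cb0 cb)).
rewrite mulr_sumr; apply: ler_sum => l _; rewrite addnS /= exprD exprMn.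
by rewrite le_eqVlt; apply/orP; left; apply/eqP; ring.
Qed.

Variables (g : 'I_n -> {mpoly C[n]}) (x v : 'cV[C]_n) (c : R).
Hypotheses (c0 : 0 <= c) (gc : derivs_bounded g x c).
Hypothesis (Jx : jacobian g x \in unitmx).
Local Notation J := (jacobian g x).
Local Notation u := (c * hnorm v).

Lemma derivs_shift_le vs : u < 1 -> (1 < size vs)%N ->
  hnorm (invmx J *m sderivs g vs (x + v)) <=
  ((size vs)`!)%:R * (c ^+ (size vs).-1 / (1 - u) ^+ (size vs).+1) *
    \prod_(w <- vs) hnorm w.
Proof.
move=> u1 vs1; have [L /(_ _ (leqnn L)) ->] := sderivs_taylor g vs x v.
apply: le_trans (taylor_tail_le _ _ gc _) _ => //.
rewrite mulrAC; apply: ler_wpM2r.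
  by apply: prodr_ge0 => w _; apply: hnorm_ge0.
apply: ler_wpM2l => //; case: (size vs) vs1 => // k _.
exact: sum_bin_newton_le c0 (hnorm_ge0 v) u1.
Qed.

(** The term l = 0 of the expansion of Dg(x + v) h gives back h; the rest is bounded by the binomial
    series without its first term. *)
Lemma jacobian_shift_le h : u < 1 ->
  hnorm (invmx J *m (jacobian g (x + v) *m h) - h) <=
  ((1 - u) ^- 2 - 1) * hnorm h.
Proof.
move=> u1; rewrite -sderivs1; have [L0 /(_ L0.+1 (leqnSn _)) ->] :=
  sderivs_taylor g [:: h] x v.
rewrite big_ltn // mulmxDr /= invr1 scale1r sderivs1 mulKmx // addrAC subrr add0r.
apply: le_trans (taylor_tail_le _ _ gc _) _ => //.
rewrite mul1r big_seq1 mulrC; apply: ler_wpM2r; first exact: hnorm_ge0.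
have := sum_bin_newton_le 0%N L0.+1 c0 (hnorm_ge0 v) u1.
by rewrite big_ltn //= bin0 !expr0 !mul1r -lerBrDl.
Qed.

(** Apply [jacobian_shift_le] to k = Dg(x + v)^-1 h: it gives (2 - (1 - u)^-2) |k| <= |Dg(x)^-1 h|,
    and the factor on the left is (1 - 4u + 2u^2) / (1 - u)^2. *)
Lemma invmx_jacobian_shift_le h : u < 1 -> 0 < 1 - 4 * u + 2 * u ^+ 2 ->
  jacobian g (x + v) \in unitmx ->
  hnorm (invmx (jacobian g (x + v)) *m h) <=
  (1 - u) ^+ 2 / (1 - 4 * u + 2 * u ^+ 2) * hnorm (invmx J *m h).
Proof.
move=> u1 psi0 Jxv; have := jacobian_shift_le (invmx (jacobian g (x + v)) *m h) u1.
rewrite (mulKVmx Jxv).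
move: (invmx (jacobian g (x + v)) *m h) (invmx J *m h) => k H kle.
have tri : hnorm k <= hnorm H + ((1 - u) ^- 2 - 1) * hnorm k.
  apply: le_trans (lerD (lexx (hnorm H)) kle).
  by have := hnorm_triangle H (- (H - k)); rewrite subKr hnorm_opp.
rewrite mulrAC ler_pdivlMr //.
have -> : hnorm k * (1 - 4 * u + 2 * u ^+ 2) =
    (1 - u) ^+ 2 * (hnorm k - ((1 - u) ^- 2 - 1) * hnorm k).
  by move: u1; set w := u => w1; field; rewrite gt_eqF // subr_gt0.
by apply: ler_wpM2l; [exact: sqr_ge0 | rewrite lerBlDr].
Qed.

Hypothesis (v_newton : v = - (invmx J *m seval g x)).

(** The choice of [v] cancels the Taylor terms of orders 0 and 1; the others contribute at most |v|
    (u + u^2 + ...). *)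
Lemma newton_residual_le : u < 1 ->
  hnorm (invmx J *m seval g (x + v)) <= hnorm v * (u / (1 - u)).
Proof.
move=> u1; rewrite -sderivs_nil; have [L0 /(_ L0.+2 (leqW (leqnSn _))) ->] :=
  sderivs_taylor g [::] x v.
rewrite big_ltn // big_ltn // !mulmxDr /= invr1 !scale1r sderivs1 mulKmx //.
rewrite sderivs_nil {1}v_newton addrA addrN add0r.
apply: le_trans (taylor_tail_le _ _ gc _) _ => //.
rewrite big_nil !mul1r /=.
have S := sum_bin_expr_le 0%N L0.+1 (mulr_ge0 c0 (hnorm_ge0 v)) u1.
rewrite big_ltn // bin0 expr0 mul1r -lerBrDl expr1 in S.
have -> : u / (1 - u) = (1 - u)^-1 - 1 by field; rewrite gt_eqF // subr_gt0.
apply: le_trans (ler_wpM2l (hnorm_ge0 v) S).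
rewrite big_add1 /= mulr_sumr [leLHS]big_nat [leRHS]big_nat.
apply: ler_sum => l /andP[l1 _].
rewrite !addn0 !binn /= !mul1r exprS exprMn.
by rewrite le_eqVlt; apply/orP; left; apply/eqP; ring.
Qed.

End NewtonStep.

(** * Convergence of Newton's iteration *)

Section AlphaTheory.
Variables (R : realType) (n : nat).
Local Notation C := R[i].
Implicit Types (g : 'I_n -> {mpoly C[n]}) (x y z zeta : 'cV[C]_n)
  (X : nat -> 'cV[C]_n).

(* [(13 - 3 * sqrt 17) / 4] is about 0.1577; the invariance under a Newton step
   needs [u <= (1 - 4 * u + 2 * u ^+ 2) ^+ 2], which holds up to 0.162. *)
Definition contracting g x := exists c : R,
  [/\ 0 <= c, derivs_bounded g x c & c * beta g x < 4 / 25].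

Lemma alpha_certified_contracting g z : alpha_certified g z -> contracting g z.
Proof.
case=> _ az; exists (gamma g z); split; first exact: gamma_ge0.
  exact: sderivs_gamma_le.
rewrite mulrC -[_ * _]/(alpha g z); apply: lt_le_trans az _.
(* The comparison with 4 / 25 amounts to sqrt 17 >= 4.12, and 4.12^2 = 16.9744. *)
have s0 : 0 <= Num.sqrt 17 :> R by apply: sqrtr_ge0.
have s2 : Num.sqrt 17 ^+ 2 = 17 :> R by rewrite sqr_sqrtr.
nra.
Qed.

Lemma newton_Some g x y : newton g x = Some y ->
  jacobian g x \in unitmx /\ y = x - invmx (jacobian g x) *m seval g x.
Proof. by rewrite /newton; case: ifP => // Jx [<-]. Qed.

Lemma newton_beta g x y : newton g x = Some y -> beta g x = hnorm (y - x).
Proof. by case/newton_Some=> _ ->; rewrite addrAC subrr add0r hnorm_opp. Qed.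

Lemma contracting_shift g x v : jacobian g x \in unitmx ->
  v = - (invmx (jacobian g x) *m seval g x) ->
  jacobian g (x + v) \in unitmx -> contracting g x ->
  contracting g (x + v) /\ 2 * beta g (x + v) <= beta g x.
Proof.
move=> Jx vE Jy [c [c0 gc]]; have -> : beta g x = hnorm v by rewrite vE hnorm_opp.
set b := hnorm v; set u := c * b => cb.
have b0 : 0 <= b by apply: hnorm_ge0.
have u0 : 0 <= u by apply: mulr_ge0.
have u1 : u < 1 by lra.
set w := 1 - u; have w0 : 0 < w by rewrite subr_gt0.
have w1 : w <= 1 by rewrite /w; lra.
pose psi := 1 - 4 * u + 2 * u ^+ 2.
(* [psi] decreases in u on [0, 4/25] and equals 0.4112 at the right end. *)
have psi41 : 41 / 100 <= psi by rewrite /psi; nra.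
have psi1 : psi <= 1 by rewrite /psi; nra.
have psi0 : 0 < psi by lra.
have inv_le h : hnorm (invmx (jacobian g (x + v)) *m h) <=
    w ^+ 2 / psi * hnorm (invmx (jacobian g x) *m h).
  exact: invmx_jacobian_shift_le.
have by_le : beta g (x + v) <= b * (u * w / psi).
  apply: le_trans (inv_le _) _.
  have := newton_residual_le c0 gc Jx vE u1; rewrite -/b => res.
  apply: le_trans (ler_wpM2l _ res) _.
    by rewrite divr_ge0 ?sqr_ge0 // ltW.
  rewrite le_eqVlt; apply/orP; left; apply/eqP; rewrite -/u -/w.
  by field; rewrite !gt_eqF.
split; last first.
  apply: le_trans (ler_wpM2l _ by_le) _ => //; rewrite mulrCA.
  (* The claim 2uw <= psi amounts to 1 - 6u + 4u^2 >= 0. *)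
  apply: ler_piMr => //; rewrite mulrA ler_pdivrMr // /w /psi; nra.
exists (c / (w * psi)); split.
- by rewrite divr_ge0 // mulr_ge0 // ltW.
- move=> vs vs1; apply: le_trans (inv_le _) _.
  have P0 : 0 <= \prod_(v <- vs) hnorm v.
    by apply: prodr_ge0 => ? _; apply: hnorm_ge0.
  apply: le_trans (ler_wpM2l _ (derivs_shift_le c0 gc u1 vs1)) _.
    by rewrite divr_ge0 ?sqr_ge0 // ltW.
  rewrite -/u -/w -/b [leLHS]mulrA; apply: ler_wpM2r => //.
  rewrite [leLHS]mulrCA; apply: ler_wpM2l => //.
  (* With [size vs] = k + 2 the factor 1 / psi is left over; it is at most psi^-(k+1) because psi <=
     1. *)
  case: (size vs) vs1 => [|[|k]] // _; rewrite /= expr_div_n exprMn.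
  have -> : w ^+ 2 / psi * (c ^+ k.+1 / w ^+ k.+3) =
      c ^+ k.+1 / w ^+ k.+1 * psi^-1.
    by rewrite !exprS; field; rewrite expf_neq0 !gt_eqF.
  rewrite invfM mulrA; apply: ler_wpM2l.
    by rewrite divr_ge0 // exprn_ge0 // ltW.
  rewrite lef_pV2 ?posrE ?exprn_gt0 // exprS.
  by rewrite ger_pMr // exprn_ile1 // ltW.
- have cw : 0 <= c / (w * psi) by rewrite divr_ge0 // mulr_ge0 // ltW.
  apply: le_lt_trans (ler_wpM2l cw by_le) _; apply: le_lt_trans (cb).
  (* The new u is at most (u / psi)^2, which is at most u because psi^2 >= 0.1681 > u. *)
  have -> : c / (w * psi) * (b * (u * w / psi)) = u ^+ 2 / psi ^+ 2.
    by rewrite /u; field; rewrite !gt_eqF.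
  rewrite ler_pdivrMr ?exprn_gt0 // expr2; apply: ler_wpM2l => //.
  have : (41 / 100) ^+ 2 <= psi ^+ 2 by rewrite lerXn2r // nnegrE; lra.
  lra.
Qed.

Lemma contracting_newton g x y : newton g x = Some y ->
  jacobian g y \in unitmx -> contracting g x ->
  contracting g y /\ 2 * beta g y <= beta g x.
Proof. by case/newton_Some=> Jx ->; apply: contracting_shift. Qed.

Lemma cvg_hnorm_lt X zeta : hnorm (X k - zeta) @[k --> \oo] --> (0 : R) ->
  forall eps, 0 < eps -> exists K, forall k, (K <= k)%N -> hnorm (X k - zeta) < eps.
Proof.
move=> /cvgrPdist_lt Xz eps eps0; have [K _ XK] := Xz _ eps0.
exists K => k Kk; have := XK k Kk; rewrite /= sub0r normrN ger0_norm //.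
exact: hnorm_ge0.
Qed.

(** The jacobian is invertible at each new iterate because the following Newton step is defined. *)
Lemma contracting_orbit g X : (forall k, newton g (X k) = Some (X k.+1)) ->
  contracting g (X 0%N) -> forall k, contracting g (X k).
Proof.
move=> XS X0; elim=> [//|k ih].
by have [] := contracting_newton (XS k) (proj1 (newton_Some (XS k.+1))) ih.
Qed.

Lemma contracting_cvg_le g X zeta :
  (forall k, newton g (X k) = Some (X k.+1)) -> contracting g (X 0%N) ->
  hnorm (X k - zeta) @[k --> \oo] --> (0 : R) ->
  hnorm (X 0%N - zeta) <= 2 * beta g (X 0%N).
Proof.
move=> XS X0 Xz.
(* The step length is [beta], which is at least halved each time, so the left side does not increase
   with k. *)
have dist k : hnorm (X k - X 0%N) + 2 * beta g (X k) <= 2 * beta g (X 0%N).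
  elim: k => [|k ih]; first by rewrite subrr hnorm0 add0r.
  apply: le_trans _ ih.
  have [_ h] := contracting_newton (XS k) (proj1 (newton_Some (XS k.+1)))
    (contracting_orbit XS X0 k).
  have := hnorm_dist_triangle (X k) (X k.+1) (X 0%N).
  have := newton_beta (XS k).
  move: (beta g (X k.+1)) (beta g (X k)) h => b1 b0 h <-.
  move: (hnorm _) (hnorm _) => d1 d0; lra.
apply/ler_addgt0Pr => eps /(cvg_hnorm_lt Xz)[K /(_ K (leqnn K)) XK].
apply: le_trans (hnorm_dist_triangle (X K) _ _) _; apply: lerD (ltW XK).
rewrite hnorm_distC; apply: le_trans (dist K).
by rewrite lerDl mulr_ge0 // hnorm_ge0.
Qed.

Lemma newton_orbit g z X :
  (forall k, iter k (obind (newton g)) (Some z) = Some (X k)) ->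
  forall k, newton g (X k) = Some (X k.+1).
Proof. by move=> XE k; rewrite -XE iterS XE. Qed.

(** [beta] is the distance between consecutive iterates, both close to the limit. This makes the
    refinement loop stop. *)
Lemma cvg_beta0 g X zeta : (forall k, newton g (X k) = Some (X k.+1)) ->
  hnorm (X k - zeta) @[k --> \oo] --> (0 : R) ->
  forall eps, 0 < eps -> exists K, forall k, (K <= k)%N -> beta g (X k) < eps.
Proof.
move=> XS Xz eps eps0; have eps2 : 0 < eps / 2 by lra.
have [K h] := cvg_hnorm_lt Xz eps2; exists K => k Kk; rewrite (newton_beta (XS k)).
apply: le_lt_trans (hnorm_dist_triangle zeta _ _) _.
have := h k Kk; have := h k.+1 (leqW Kk); rewrite (hnorm_distC zeta); lra.
Qed.

End AlphaTheory.

(** * The algorithm *)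

Lemma card_eq_exists_inj (T : Type) (A : set T) k : (A #= `I_k)%card ->
  exists2 h : 'I_k -> T, injective h & forall i, A (h i).
Proof.
move=> /card_set_bijP[f [_ _ fsurj]].
have h_ex (i : 'I_k) : exists a, A a /\ f a = i :> nat.
  by have [a Aa fa] := fsurj i (ltn_ord i); exists a.
have [h hP] := choice h_ex.
exists h => [i j ij|i]; last by have [] := hP i.
by apply: val_inj; rewrite /= -(hP i).2 -(hP j).2 ij.
Qed.

(** Pigeonhole; it makes the d distinct associated solutions exhaust the zeros of [g] and of
    [g']. *)
Lemma card_eq_inj_onto (T : Type) (A : set T) k (F : 'I_k -> T) :
  (A #= `I_k)%card -> injective F -> (forall i, A (F i)) ->
  forall a, A a -> exists i, F i = a.
Proof.
move=> /card_set_bijP[h [hA hinj _]] Finj FA a Aa.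
pose G i : 'I_k := Ordinal (hA _ (FA i)).
have Ginj : injective G.
  by move=> i j [ij]; apply: Finj; apply: hinj ij; rewrite inE.
have [G' _ GK] := injF_bij Ginj.
exists (G' (Ordinal (hA _ Aa))); apply: hinj; rewrite ?inE //.
by have [] := GK (Ordinal (hA _ Aa)).
Qed.

Section AlgorithmRuns.
Variables (R : realType) (n d : nat).
Local Notation point := 'cV[R[i]]_n.
Variables (g' : 'I_n -> {mpoly R[i][n]}).
Variables (zS : 'I_d -> point) (rho : 'I_d -> R).

Lemma small_enough_near0 :
  (forall i j, i != j -> hnorm (zS i - zS j) > rho i + rho j) ->
  exists2 eps : R, 0 < eps &
    forall z, beta g' z < eps -> small_enough g' zS rho z.
Proof.
move=> hB; have : (0 < separation zS rho)%E.
  rewrite /separation; elim/big_ind: _ => // [x y x0 y0|[i j] /= ij].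
    by rewrite lt_min x0.
  by rewrite lte_fin subr_gt0 hB // -val_eqE /= ltn_eqF.
(* A real separation r gives the threshold r / 6; for +oo, the value over no pairs, every threshold
   works; -oo contradicts positivity. *)
rewrite /small_enough; case: (separation zS rho) => [r|_|//].
  rewrite lte_fin => r0; exists (r / 6); first by rewrite divr_gt0.
  move=> z; rewrite -EFinM lte_fin; lra.
by exists 1 => // z _; rewrite gt0_mulye ?ltry // lte_fin.
Qed.

Lemma refine_until_orbit z w (X : nat -> point) :
  (forall k, newton g' (X k) = Some (X k.+1)) -> X 0%N = z ->
  refine_until g' zS rho z w -> exists k, w = X k.
Proof.
move=> XS X0 zw; elim: zw X XS X0 => {z w} [z z1 zz1 _ _|z z1 w zz1 _ _ _ ih] X XS X0.
  by exists 1%N; apply: Some_inj; rewrite -XS X0.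
have [|k ->] := ih (fun k => X k.+1) (fun k => XS k.+1); last by exists k.+1.
by apply: Some_inj; rewrite -XS X0.
Qed.

(** The index is [m.+1] because the loop takes a Newton step before its first test. *)
Lemma refine_until_ex (X : nat -> point) m :
  (forall k, newton g' (X k) = Some (X k.+1)) ->
  small_enough g' zS rho (X m.+1) ->
  exists w, refine_until g' zS rho (X 0%N) w.
Proof.
elim: m X => [|m ih] X XS sm; have J1 := proj1 (newton_Some (XS 1%N)).
  by exists (X 1%N); apply: refine_stop (XS 0%N) J1 sm.
have [s1|s1] := boolP (small_enough g' zS rho (X 1%N)).
  by exists (X 1%N); apply: refine_stop (XS 0%N) J1 s1.
have [w Xw] := ih (fun k => X k.+1) (fun k => XS k.+1) sm.
by exists w; apply: refine_again (XS 0%N) J1 s1 Xw.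
Qed.

Lemma in_add_meeting w (T : {fset point}) y :
  (y \in add_meeting g' zS rho w T) =
  (y \in T) || [exists j, balls_meet g' zS rho w j && (y == zS j)].
Proof.
have -> : [exists j, balls_meet g' zS rho w j && (y == zS j)] =
    has (fun j => balls_meet g' zS rho w j && (y == zS j)) (enum 'I_d).
  apply/existsP/hasP => [[j jP]|[j _ jP]]; exists j => //.
  exact: mem_enum.
rewrite /add_meeting; elim: (enum 'I_d) T => [|j s ih] T /=; first by rewrite orbF.
rewrite ih; case: balls_meet => //=.
by rewrite in_fset1U orbCA orbA.
Qed.

Lemma process_ex s T : (forall z, z \in s -> exists w, refine_until g' zS rho z w) ->
  exists T', process g' zS rho s T T'.
Proof.
elim: s T => [|z s ih] T sP; first by exists T; constructor.
have [w zw] := sP z (mem_head _ _).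
have [|T' sT'] := ih (add_meeting g' zS rho w T).
  by move=> y ys; apply: sP; rewrite in_cons ys orbT.
by exists T'; apply: process_cons zw sT'.
Qed.

Lemma process_sub s T T' : process g' zS rho s T T' -> {subset T <= T'}.
Proof.
elim=> {s T T'} [T //|z w s T T' _ _ ih y yT].
by apply: ih; rewrite in_add_meeting yT.
Qed.

Lemma process_le s T T' : process g' zS rho s T T' ->
  forall y, y \in T' -> y \in T \/ exists j, y = zS j.
Proof.
elim=> {s T T'} [T y|z w s T T' _ _ ih y /ih]; first by left.
rewrite in_add_meeting => -[/orP[|/existsP[j /andP[_ /eqP ->]]]|]; last by right.
  by left.
by right; exists j.
Qed.

(** The set only grows, so what is added while handling [z] is still in the final [T']. *)
Lemma process_meet s T T' : process g' zS rho s T T' -> forall z, z \in s ->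
  exists2 w, refine_until g' zS rho z w &
    forall j, balls_meet g' zS rho w j -> zS j \in T'.
Proof.
elim=> {s T T'} [T y|z w s T T' zw sT' ih y]; first by rewrite in_nil.
rewrite in_cons => /predU1P[->|/ih //].
exists w => // j wj; apply: (process_sub sT'); rewrite in_add_meeting.
by apply/orP; right; apply/existsP; exists j; rewrite wj eqxx.
Qed.

End AlgorithmRuns.

(** A loop that does not stop would leave [algorithm_returns] without any output; the first conjunct
    is therefore termination, the second correctness of every output. *)
Theorem theorem3p3 (R : realType) (n N d e : nat) (hnN : (n <= N)%N)
    (f : 'I_N -> {mpoly R[i][n]}) (hfe : (zeros f #= `I_e)%card)
    (hfd : general_square_subsystems_have f d)
    (g g' : 'I_n -> {mpoly R[i][n]})
    (hg : square_subsystem f g) (hgd : (zeros g #= `I_d)%card)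
    (hg' : square_subsystem f g') (hgd' : (zeros g' #= `I_d)%card)
    (zS : 'I_d -> 'cV[R[i]]_n) (rho : 'I_d -> R)
    (Ng : 'cV[R[i]]_n -> option 'cV[R[i]]_n)
    (hS : distinct_approximate_solutions g zS rho Ng)
    (hB : forall i j, i != j -> hnorm (zS i - zS j) > rho i + rho j)
    (zS' : 'I_d -> 'cV[R[i]]_n) (rho' : 'I_d -> R)
    (hS' : distinct_approximate_solutions g' zS' rho' (newton g'))
    (hS'alpha : forall i, alpha_certified g' (zS' i)) :
  (exists out, algorithm_returns e g' zS rho zS' out) /\
  (forall out, algorithm_returns e g' zS rho zS' out ->
     out = None \/
     exists T : {fset 'cV[R[i]]_n},
       [/\ out = Some T,
           (T `<=` [fset zS i | i in 'I_d])%fset,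
           forall i, zS i \in T -> approximate_solution f (zS i) (rho i) Ng &
           [set zeta | exists2 i, zS i \in T &
              associated_solution f (zS i) (rho i) Ng zeta] = zeros f]).
Proof.
have [hSa hSd] := hS; have [hSa' hSd'] := hS'.
have zeta_ex i : exists zeta, associated_solution g (zS i) (rho i) Ng zeta.
  by have [] := hSa i.
have zeta'_ex i : exists zeta,
    associated_solution g' (zS' i) (rho' i) (newton g') zeta.
  by have [] := hSa' i.
have [zeta zetaP] := choice zeta_ex; have [zeta' zeta'P] := choice zeta'_ex.
have zeta_inj : injective zeta.
  move=> i j ij; apply/eqP; apply: contraT => /hSd /(_ (zetaP i) (zetaP j)).
  by rewrite ij.
have zeta'_inj : injective zeta'.
  move=> i j ij; apply/eqP; apply: contraT => /hSd' /(_ (zeta'P i) (zeta'P j)).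
  by rewrite ij.
(* Equal centres would give 0 > rho i + rho j, against the positivity of the radii. *)
have zS_inj : injective zS.
  move=> i j ij; apply/eqP; apply: contraT => /hB; rewrite ij subrr hnorm0.
  by have [ri _] := hSa i; have [rj _] := hSa j; rewrite ltNge addr_ge0 // ltW.
have zeta_onto : forall a, zeros f a -> exists i, zeta i = a.
  move=> a fa; apply: (card_eq_inj_onto hgd zeta_inj _ (hg _ fa)) => i.
  by have [] := zetaP i.
have zeta'_onto : forall a, zeros f a -> exists i, zeta' i = a.
  move=> a fa; apply: (card_eq_inj_onto hgd' zeta'_inj _ (hg' _ fa)) => i.
  by have [] := zeta'P i.
have X_ex i : exists X : nat -> 'cV[R[i]]_n,
    [/\ X 0%N = zS' i, forall k, newton g' (X k) = Some (X k.+1) &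
        hnorm (X k - zeta' i) @[k --> \oo] --> (0 : R)].
  have [_ _ [X XE Xz]] := zeta'P i.
  by exists X; split => //; [apply: Some_inj; rewrite -XE | exact: newton_orbit XE].
have [X XP] := choice X_ex.
split.
  have [eps eps0 epsP] := small_enough_near0 g' hB.
  have [|T sT] := @process_ex _ _ _ g' zS rho [seq zS' i | i <- enum 'I_d] fset0.
    move=> _ /mapP[i _ ->]; have [<- XS Xz] := XP i.
    have [K /(_ K.+1 (leqnSn K)) /epsP] := cvg_beta0 XS Xz eps0.
    exact: refine_until_ex.
  by eexists; exists T.
move=> _ [T sT ->]; case: eqP => [Te|_]; last by left.
right; exists T.
have meet j : zeros f (zeta j) -> zS j \in T.
  move=> /zeta'_onto[i ij]; have [Xi0 XS Xz] := XP i.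
  have [|w zw wT] := process_meet sT (z := zS' i).
    by rewrite map_f ?mem_enum.
  apply: wT; have [k ->] := refine_until_orbit XS Xi0 zw.
  have X0 : contracting g' (X i 0%N).
    by rewrite Xi0; apply: alpha_certified_contracting.
  (* The refined point is the k-th iterate; the orbit restarted there has the same limit, so the
     error bound applies to it. *)
  have Xzk : hnorm (X i (m + k)%N - zeta' i) @[m --> \oo] --> (0 : R).
    by rewrite (cvg_shiftn k (fun m => hnorm (X i m - zeta' i))).
  have := contracting_cvg_le (X := fun m => X i (m + k)%N) (fun m => XS (m + k)%N)
    (contracting_orbit XS X0 k) Xzk.
  (* The strict test of [balls_meet] is met because [zeta j] lies strictly within [rho j] of
     [zS j]. *)
  have [_ zj _] := zetaP j; rewrite ij /balls_meet.
  have := hnorm_dist_triangle (zeta j) (zS j) (X i k).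
  rewrite (hnorm_distC (zS j) (zeta j)) (hnorm_distC (zeta j) (X i k)); lra.
have [h h_inj h_f] := card_eq_exists_inj hfe.
have [jj jjP] := choice (fun k => zeta_onto (h k) (h_f k)).
have jj_inj : injective jj by move=> k l kl; apply: h_inj; rewrite -!jjP kl.
(* The e points belonging to the solutions of [f] are distinct and lie in [T], which has e
   elements. *)
have TE : [fset zS (jj k) | k in 'I_e]%fset = T.
  apply/eqP; rewrite eqEfcard Te card_imfset /=; last first.
    by move=> k l /zS_inj /jj_inj.
  rewrite size_enum_ord leqnn andbT; apply/fsubsetP => _ /imfsetP[k _ ->].
  by apply: meet; rewrite jjP.
have zeros_T i : zS i \in T -> zeros f (zeta i).
  by rewrite -TE => /imfsetP[k _ /zS_inj ->]; rewrite jjP.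
(* Radius, operator and limit are the same as for [g]; only the system that vanishes at the limit
   changes. *)
have assoc_T i : zeros f (zeta i) ->
    associated_solution f (zS i) (rho i) Ng (zeta i).
  by move=> fi; have [] := zetaP i.
split => //.
- apply/fsubsetP => y /(process_le sT)[|[j ->]]; first by rewrite in_fset0.
  by apply/imfsetP; exists j.
- move=> i /zeros_T fi; split; first by have [] := hSa i.
  by exists (zeta i); apply: assoc_T.
- apply/seteqP; split=> [z [i _ []] //|z fz].
  have [i iz] := zeta_onto z fz; rewrite -iz in fz *.
  by exists i; [apply: meet | apply: assoc_T].
Qed.
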